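(* Let $z=(x,y)\in\mathbb{S}^7_T$. Then the tangent algebra of $\mathbb{S}^7_T$ at $z$ is nonsingular if and only if $\|x\|\neq\|y\|$.
   Context: Let $\mathbb{S}^7\subset\mathbb{R}^4\times\mathbb{R}^4\cong\mathbb{H}^2$ be the unit sphere with points $z=(x,y)$ and standard metric $\langle\cdot,\cdot\rangle$. Define $X_l(z)=A_lz$, $l=1,\dots,7$, where $$A_1(x,y)=(y{\bf k},x{\bf k}),\quad A_2(x,y)=(y{\bf j},x{\bf j}),\quad A_3(x,y)=(-y{\bf i},-x{\bf i}),\quad A_4(x,y)=(y,-x),$$ $$A_5(x,y)=({\bf i}x,-{\bf i}y),\quad A_6(x,y)=({\bf j}x,-{\bf j}y),\quad A_7(x,y)=({\bf k}x,-{\bf k}y).$$ These vector fields on $\mathbb{S}^7$ are pointwise orthonormal. $\mathbb{S}^7_T$ is the subriemannian manifold $(\mathbb{S}^7,\mathcal{H}_T,\langle\cdot,\cdot\rangle)$ with $\mathcal{H}_T=\mathrm{Span}\{X_1,\dots,X_4\}$ and the restricted metric; it is of step two. The tangent algebra (nilpotent approximation) of $\mathbb{S}^7_T$ at $z$ is the step two Carnot algebra $\mathfrak{g}_z=\mathcal{H}_z\oplus\mathcal{V}_z$ with $\mathcal{H}_z=\mathrm{Span}\{X_i(z):i=1,\dots,4\}$, $\mathcal{V}_z=\mathrm{Span}\{X_k(z):k=5,6,7\}$, brackets $[X_i(z),X_j(z)]:=\sum_{k=5}^7\langle[X_i,X_j],X_k\rangle_zX_k(z)$ for $1\le i,j\le4$,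 all other brackets zero, and inner product $\langle\cdot,\cdot\rangle_z$ on $\mathcal{H}_z$. A step two Carnot algebra $\mathfrak{g}=\mathfrak{g}_1\oplus\mathfrak{g}_2$ with inner product on $\mathfrak{g}_1$ is nonsingular if for every $Z\in\mathfrak{g}_2^*\setminus\{0\}$ the map $J_Z:\mathfrak{g}_1\to\mathfrak{g}_1$ defined by $\langle J_ZX,Y\rangle=Z([X,Y])$ for $X,Y\in\mathfrak{g}_1$ is invertible; otherwise it is singular. *)

(* Defs.v *)
From HB Require Import structures.
From mathcomp Require Import all_boot all_order all_algebra.
From mathcomp Require Import ring lra.
From mathcomp Require Import all_classical all_reals all_analysis.

Set Implicit Arguments.
Unset Strict Implicit.
Unset Printing Implicit Defensive.

Import Order.TTheory GRing.Theory Num.Theory.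
Import numFieldNormedType.Exports.

Local Open Scope ring_scope.

(* The Lie algebra is g1 (+) g2. Since g2 is central and [g1, g1] lies in g2,
   the whole Lie bracket is given by its restriction g1 x g1 -> g2:
   [X + U, Y + V] = bra X Y; the Jacobi identity is then automatic. *)
Structure carnot2 (R : realType) := Carnot2 {
  g1 : vectType R;
  g2 : vectType R;
  ip : g1 -> g1 -> R;
  bra : g1 -> g1 -> g2;
  ip_linear : forall a X X' Y, ip (a *: X + X') Y = a * ip X Y + ip X' Y;
  ip_sym : forall X Y, ip X Y = ip Y X;
  ip_pos : forall X, X != 0 -> 0 < ip X X;
  bra_linear : forall a X X' Y,
    bra (a *: X + X') Y = a *: bra X Y + bra X' Y;
  bra_alt : forall X Y, bra X Y = - bra Y X;
  (* [g1, g1] = g2 *)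
  bra_span : forall W : {vspace g2}, (forall X Y, bra X Y \in W) -> W = fullv;
  g2_neq0 : (fullv : {vspace g2}) != 0%VS
}.

Definition is_J (R : realType) (g : carnot2 R) (Z : 'Hom(g2 g, R^o))
    (J : 'End(g1 g)) : Prop :=
  forall X Y, ip (J X) Y = Z (bra X Y).

(* Such an endomorphism exists and is unique: is_J_exists, is_J_uniq below. *)
Definition Jmap (R : realType) (g : carnot2 R) (Z : 'Hom(g2 g, R^o)) :
  'End(g1 g) := xget 0 [set J | is_J Z J]%classic.

Definition nonsingular (R : realType) (g : carnot2 R) : Prop :=
  forall Z : 'Hom(g2 g, R^o), Z != 0 -> bijective (Jmap Z).

Section JmapTheory.
Context {R : realType} (g : carnot2 R).

Lemma ip_linearr (X : g1 g) a Y Y' :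
  ip X (a *: Y + Y') = a * ip X Y + ip X Y'.
Proof. by rewrite ip_sym ip_linear !(ip_sym _ X). Qed.

Lemma ip0 (Y : g1 g) : ip 0 Y = 0.
Proof. by have := ip_linear 1 0 0 Y; rewrite scaler0 addr0 mul1r; lra. Qed.

Lemma bra_linearr (X : g1 g) a Y Y' :
  bra X (a *: Y + Y') = a *: bra X Y + bra X Y'.
Proof. by rewrite bra_alt bra_linear opprD -scalerN -!bra_alt. Qed.

Let flat0 (X Y : g1 g) : R^o := ip X Y.
HB.instance Definition _ X := @GRing.isLinear.Build R (g1 g) R^o _ (flat0 X)
  (fun a => ip_linearr X a).
Let flat1 (X : g1 g) : 'Hom(g1 g, R^o) := linfun (flat0 X).
Fact flat1_linear : linear flat1.
Proof.
move=> a X X'; apply/lfunP => Y.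
by rewrite add_lfunE scale_lfunE !lfunE; exact: ip_linear.
Qed.
HB.instance Definition _ :=
  @GRing.isLinear.Build R (g1 g) 'Hom(g1 g, R^o) _ flat1 flat1_linear.

Let brZ0 (Z : 'Hom(g2 g, R^o)) (X Y : g1 g) : R^o := Z (bra X Y).
Fact brZ0_linear Z X : linear (brZ0 Z X).
Proof. by move=> a Y Y'; rewrite /brZ0 bra_linearr linearP. Qed.
HB.instance Definition _ Z X :=
  @GRing.isLinear.Build R (g1 g) R^o _ (brZ0 Z X) (brZ0_linear Z X).
Let brZ1 Z (X : g1 g) : 'Hom(g1 g, R^o) := linfun (brZ0 Z X).
Fact brZ1_linear Z : linear (brZ1 Z).
Proof.
move=> a X X'; apply/lfunP => Y.
by rewrite add_lfunE scale_lfunE !lfunE /= /brZ0 bra_linear linearP.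
Qed.
HB.instance Definition _ Z :=
  @GRing.isLinear.Build R (g1 g) 'Hom(g1 g, R^o) _ (brZ1 Z) (brZ1_linear Z).

Lemma is_J_uniq (Z : 'Hom(g2 g, R^o)) J J' : is_J Z J -> is_J Z J' -> J = J'.
Proof.
move=> hJ hJ'; apply/lfunP => X; apply/eqP; rewrite -subr_eq0.
apply: contraT => /ip_pos; set D := J X - J' X => D0.
have : ip D D = 0.
  rewrite {1}/D addrC -scaleN1r ip_linear hJ hJ'; ring.
by move=> E; rewrite E ltxx in D0.
Qed.

Lemma is_J_exists (Z : 'Hom(g2 g, R^o)) : exists J, is_J Z J.
Proof.
have kf : lker (linfun flat1) == 0%VS.
  apply/lker0P => X X' E0'; apply/eqP; rewrite -subr_eq0.
  apply: contraT => /ip_pos; set D := X - X' => D0.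
  have E' : ip X D = ip X' D.
    have := congr1 (fun f : 'Hom(g1 g, R^o) => f D) E0'.
    by rewrite ![linfun flat1 _]lfunE !lfunE.
  have : ip D D = 0 by rewrite {1}/D addrC -scaleN1r ip_linear E'; ring.
  by move=> E0; rewrite E0 ltxx in D0.
have imf : limg (linfun flat1) = fullv.
  apply/eqP; rewrite eqEdim subvf limg_dim_eq; last first.
    by rewrite (eqP kf) capv0.
  by rewrite !dimvf /dim /= /dim /= muln1.
exists ((linfun flat1)^-1 \o linfun (brZ1 Z))%VF => X Y.
rewrite comp_lfunE.
have : linfun flat1 (((linfun flat1)^-1)%VF (linfun (brZ1 Z) X)) =
   linfun (brZ1 Z) X by rewrite limg_lfunVK // imf memvf.
move: (_^-1%VF _) => w E; have := congr1 (fun f : 'Hom(g1 g, R^o) => f Y) E.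
by rewrite [linfun flat1 _]lfunE [linfun (brZ1 Z) _]lfunE !lfunE.
Qed.

Lemma JmapP (Z : 'Hom(g2 g, R^o)) : is_J Z (Jmap Z).
Proof. by rewrite /Jmap; case: xgetP => // /=; have [J hJ] := is_J_exists Z => /(_ J). Qed.

Lemma Jmap_eq (Z : 'Hom(g2 g, R^o)) J : is_J Z J -> J = Jmap Z.
Proof. by move/is_J_uniq; apply; exact: JmapP. Qed.

End JmapTheory.

Definition quat (R : realType) (a b c d : R) : 'rV[R]_4 :=
  \row_(n < 4) [:: a; b; c; d]`_n.

(* n-th coordinate in the basis 1, i, j, k of the quaternions *)
Definition qc (R : realType) (p : 'rV[R]_4) (n : nat) : R := p 0 (inord n).

Definition qmul (R : realType) (p q : 'rV[R]_4) : 'rV[R]_4 :=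
  quat
    (qc p 0 * qc q 0 - qc p 1 * qc q 1 - qc p 2 * qc q 2 - qc p 3 * qc q 3)
    (qc p 0 * qc q 1 + qc p 1 * qc q 0 + qc p 2 * qc q 3 - qc p 3 * qc q 2)
    (qc p 0 * qc q 2 - qc p 1 * qc q 3 + qc p 2 * qc q 0 + qc p 3 * qc q 1)
    (qc p 0 * qc q 3 + qc p 1 * qc q 2 - qc p 2 * qc q 1 + qc p 3 * qc q 0).

Definition qi (R : realType) : 'rV[R]_4 := quat 0 1 0 0.
Definition qj (R : realType) : 'rV[R]_4 := quat 0 0 1 0.
Definition qk (R : realType) : 'rV[R]_4 := quat 0 0 0 1.

Definition dot4 (R : realType) (p q : 'rV[R]_4) : R :=
  \sum_(n < 4) p 0 n * q 0 n.

(* The Euclidean norm; the library's norm on row vectors is the sup norm. *)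
Definition norm4 (R : realType) (p : 'rV[R]_4) : R := Num.sqrt (dot4 p p).

Definition H2 (R : realType) := ('rV[R]_4 * 'rV[R]_4)%type.

Definition dot (R : realType) (z w : H2 R) : R :=
  dot4 z.1 w.1 + dot4 z.2 w.2.

Definition S7 (R : realType) := {z : H2 R | dot z z == 1}.

(* Xfield l is the field X_l for 1 <= l <= 7, given by its linear extension to H^2. *)
Definition Xfield (R : realType) (l : nat) (z : H2 R) : H2 R :=
  let: (x, y) := z in
  match l with
  | 1 => (qmul y (qk R), qmul x (qk R))
  | 2 => (qmul y (qj R), qmul x (qj R))
  | 3 => (- qmul y (qi R), - qmul x (qi R))
  | 4 => (y, - x)
  | 5 => (qmul (qi R) x, - qmul (qi R) y)
  | 6 => (qmul (qj R) x, - qmul (qj R) y)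
  | 7 => (qmul (qk R) x, - qmul (qk R) y)
  | _ => 0%R
  end%N.

(* For fields tangent to S^7 (Xfield_tangent) this is, at points of S^7, the Lie bracket of
   their restrictions to S^7. *)
Definition lie (R : realType) (F G : H2 R -> H2 R) (z : H2 R) : H2 R :=
  'D_(F z) G z - 'D_(G z) F z.

Definition horbasis (R : realType) (z : H2 R) : 4.-tuple (H2 R) :=
  [tuple Xfield (i + 1) z | i < 4].
Definition vertbasis (R : realType) (z : H2 R) : 3.-tuple (H2 R) :=
  [tuple Xfield (k + 5) z | k < 3].

Definition Hsp (R : realType) (z : H2 R) : {vspace H2 R} := <<horbasis z>>%VS.
Definition Vsp (R : realType) (z : H2 R) : {vspace H2 R} := <<vertbasis z>>%VS.

Definition bracket_coef (R : realType) (z : H2 R) (i j k : nat) : R :=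
  dot (lie (@Xfield R i) (@Xfield R j) z) (Xfield k z).

(* Coordinates are taken in the basis X_1(z), ..., X_4(z) of H_z
   (horbasis_free), so this is the bilinear extension (tangent_bra_basis) of
   [X_i(z), X_j(z)] = \sum_(k = 5, 6, 7) <[X_i, X_j], X_k>_z X_k(z). *)
Definition tangent_bra (R : realType) (z : H2 R)
    (u v : subvs_of (Hsp z)) : subvs_of (Vsp z) :=
  \sum_(i < 4) \sum_(j < 4)
    (coord (horbasis z) i (val u) * coord (horbasis z) j (val v)) *:
      \sum_(k < 3) bracket_coef z (i + 1) (j + 1) (k + 5) *:
        vsproj (Vsp z) (Xfield (k + 5) z).

Definition tangent_ip (R : realType) (z : H2 R) (u v : subvs_of (Hsp z)) : R :=
  dot (val u) (val v).

Section TangentAlgebra.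
Context {R : realType}.
Implicit Types (p q : 'rV[R]_4) (z w : H2 R).

Lemma dot4E p q : dot4 p q =
  qc p 0 * qc q 0 + qc p 1 * qc q 1 + qc p 2 * qc q 2 + qc p 3 * qc q 3.
Proof.
rewrite /dot4 !big_ord_recl big_ord0 addr0 /qc !addrA.
by do !congr (_ + _); congr (p 0 _ * q 0 _); apply/val_inj; rewrite /= inordK.
Qed.

Lemma qc_quat (a b c d : R) :
  ((qc (quat a b c d) 0 = a) * (qc (quat a b c d) 1 = b) *
   (qc (quat a b c d) 2 = c) * (qc (quat a b c d) 3 = d))%type.
Proof. by rewrite /qc !mxE !inordK. Qed.

Lemma qcN p n : qc (- p) n = - qc p n. Proof. by rewrite /qc mxE. Qed.
Lemma qcD p q n : qc (p + q) n = qc p n + qc q n.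
Proof. by rewrite /qc mxE. Qed.
Lemma qcZ (a : R) p n : qc (a *: p) n = a * qc p n.
Proof. by rewrite /qc mxE. Qed.
Lemma qc0 n : qc (0 : 'rV[R]_4) n = 0. Proof. by rewrite /qc mxE. Qed.

Lemma qcP p q : (forall n, (n < 4)%N -> qc p n = qc q n) -> p = q.
Proof.
by move=> E; apply/rowP => i; have := E i (ltn_ord i); rewrite /qc inord_val.
Qed.

Definition qcE := (qc_quat, qcN, qcD, qcZ, qc0).

Lemma qmul_units p :
  (((qmul p (qi R) = quat (- qc p 1) (qc p 0) (qc p 3) (- qc p 2)) *
    (qmul p (qj R) = quat (- qc p 2) (- qc p 3) (qc p 0) (qc p 1)) *
    (qmul p (qk R) = quat (- qc p 3) (qc p 2) (- qc p 1) (qc p 0))) *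
   ((qmul (qi R) p = quat (- qc p 1) (qc p 0) (- qc p 3) (qc p 2)) *
    (qmul (qj R) p = quat (- qc p 2) (qc p 3) (qc p 0) (- qc p 1)) *
    (qmul (qk R) p = quat (- qc p 3) (- qc p 2) (qc p 1) (qc p 0))))%type.
Proof. by do !split; apply: qcP => -[|[|[|[|//]]]] _; rewrite !qcE; ring. Qed.

Lemma qmul_lin p a q q' : qmul p (a *: q + q') = a *: qmul p q + qmul p q'.
Proof. by apply: qcP => -[|[|[|[|//]]]] _; rewrite !qcE; ring. Qed.

Lemma qmul_linl p a q q' : qmul (a *: q + q') p = a *: qmul q p + qmul q' p.
Proof. by apply: qcP => -[|[|[|[|//]]]] _; rewrite !qcE; ring. Qed.

Lemma dot_linear (a : R) z z' w : dot (a *: z + z') w = a * dot z w + dot z' w.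
Proof. by rewrite /dot /= !dot4E !qcE; ring. Qed.

Lemma dot0 w : dot 0 w = 0.
Proof. by have := dot_linear 1 0 0 w; rewrite scaler0 addr0 mul1r; lra. Qed.

Lemma dot_sym z w : dot z w = dot w z.
Proof. by rewrite /dot !dot4E; ring. Qed.

Lemma dot_pos z : z != 0 -> 0 < dot z z.
Proof.
move=> z0; have dot4_ge0 p : 0 <= dot4 p p.
  by rewrite sumr_ge0 // => i _; rewrite -expr2 sqr_ge0.
have dot4_eq0 p : dot4 p p = 0 -> p = 0.
  move=> /eqP; rewrite psumr_eq0 => [/allP E|i _]; last first.
    by rewrite -expr2 sqr_ge0.
  apply/rowP => i; have /implyP := E i (mem_index_enum i).
  by rewrite mulf_eq0 orbb mxE => /(_ isT)/eqP.
rewrite lt_neqAle eq_sym addr_ge0 // andbT; apply: contra z0.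
rewrite paddr_eq0 // => /andP[/eqP/dot4_eq0 E1 /eqP/dot4_eq0 E2].
by case: z E1 E2 => x y /= -> ->.
Qed.

Lemma Xfield_linear l : linear (@Xfield R l).
Proof.
move=> a [x y] [x' y']; rewrite /Xfield /=.
have P (u v u' v' : 'rV[R]_4) : u = u' -> v = v' -> (u, v) = (u', v') by move=> -> ->.
case: l => [|[|[|[|[|[|[|[|l]]]]]]]]; rewrite ?scaler0 ?addr0 //;
  apply: P; rewrite /= ?qmul_lin ?qmul_linl ?scalerN ?opprD //.
Qed.

Lemma derive_linear (f : H2 R -> H2 R) (z v : H2 R) : linear f -> 'D_v f z = f v.
Proof.
move=> fl; rewrite /derive; apply: cvg_lim => //.
apply: (@cvg_trans _ ((fun=> f v) @ (0 : R)^')%classic); last exact: cvg_cst.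
apply: near_eq_cvg; near=> h.
rewrite /= fl addrK scalerA mulVf ?scale1r //.
by near: h; exact: nbhs_dnbhs_neq.
Unshelve. all: by end_near. Qed.

Lemma lieE i j z : lie (@Xfield R i) (@Xfield R j) z =
  Xfield j (Xfield i z) - Xfield i (Xfield j z).
Proof. by rewrite /lie !derive_linear //; exact: Xfield_linear. Qed.

Lemma Xfield_orthonormal i j z : (0 < i < 8)%N -> (0 < j < 8)%N ->
  dot (Xfield i z) (Xfield j z) = (i == j)%:R * dot z z.
Proof.
case: z => x y.
case: i => [|[|[|[|[|[|[|[|i]]]]]]]] // _;
case: j => [|[|[|[|[|[|[|[|j]]]]]]]] // _;
rewrite /dot /= ?qmul_units ?dot4E !qcE ?mul1r ?mul0r; ring.
Qed.

Lemma Xfield_tangent l z : dot (Xfield l z) z = 0.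
Proof.
case: z => x y; case: l => [|[|[|[|[|[|[|[|l]]]]]]]];
rewrite ?dot0 // /dot /= ?qmul_units ?dot4E !qcE; ring.
Qed.

Lemma dot_suml (I : finType) (a : I -> R) (v : I -> H2 R) w :
  dot (\sum_i a i *: v i) w = \sum_i a i * dot (v i) w.
Proof.
by elim/big_rec2: _ => [|i b c _ <-]; rewrite ?dot0 ?dot_linear.
Qed.

Lemma horbasisE z (i : 'I_4) : (horbasis z)`_i = Xfield (i + 1) z.
Proof. by rewrite /horbasis nth_mktuple. Qed.

Lemma vertbasisE z (k : 'I_3) : (vertbasis z)`_k = Xfield (k + 5) z.
Proof. by rewrite /vertbasis nth_mktuple. Qed.

Lemma horbasis_free z : dot z z == 1 -> free (horbasis z).
Proof.
move=> /eqP z1; apply/freeP => a E i.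
have lt8 (j : 'I_4) : (0 < j + 1 < 8)%N.
  by rewrite addn1 /= ltnS; apply: leq_trans (ltn_ord j) _.
have E' : \sum_(j < 4) a j *: Xfield (j + 1) z = 0.
  by rewrite -[RHS]E; apply: eq_bigr => j _; rewrite horbasisE.
have := congr1 (fun u : H2 R => dot u (Xfield (i + 1) z)) E'.
rewrite /= dot0 dot_suml (bigD1 i) // big1 => [|j ji]; last first.
  rewrite Xfield_orthonormal ?lt8 //.
  by rewrite eqn_add2r (inj_eq val_inj) (negbTE ji) mul0r mulr0.
rewrite /= addr0 Xfield_orthonormal ?lt8 //.
by rewrite eqxx z1 !mulr1.
Qed.

Lemma Hsp_mem z (i : 'I_4) : Xfield (i + 1) z \in Hsp z.
Proof.
apply: memv_span; have -> : Xfield (i + 1) z = tnth (horbasis z) i.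
  by rewrite tnth_mktuple.
exact: mem_tnth.
Qed.

Lemma Vsp_mem z (k : 'I_3) : Xfield (k + 5) z \in Vsp z.
Proof.
apply: memv_span; have -> : Xfield (k + 5) z = tnth (vertbasis z) k.
  by rewrite tnth_mktuple.
exact: mem_tnth.
Qed.

Lemma sum_delta (V : lmodType R) (i j : 'I_4) (f g : 'I_4 -> R)
    (h : 'I_4 -> 'I_4 -> V) :
  (forall a, f a = (a == i)%:R) -> (forall b, g b = (b == j)%:R) ->
  \sum_a \sum_b (f a * g b) *: h a b = h i j.
Proof.
move=> fE gE; rewrite (bigD1 i) //= (bigD1 j) //= fE gE !eqxx mulr1 scale1r.
rewrite big1 ?addr0 => [|b bj]; last by rewrite gE (negbTE bj) mulr0 scale0r.
rewrite big1 ?addr0 // => a ai; rewrite big1 // => b _.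
by rewrite fE (negbTE ai) mul0r scale0r.
Qed.

Lemma tangent_bra_basis z (i j : 'I_4) : dot z z == 1 ->
  tangent_bra (vsproj (Hsp z) (Xfield (i + 1) z))
              (vsproj (Hsp z) (Xfield (j + 1) z)) =
  \sum_(k < 3) bracket_coef z (i + 1) (j + 1) (k + 5) *:
    vsproj (Vsp z) (Xfield (k + 5) z).
Proof.
move=> z1; have c (a b : 'I_4) :
    coord (horbasis z) a (val (vsproj (Hsp z) (Xfield (b + 1) z))) = (a == b)%:R.
  rewrite /= vsprojK ?Hsp_mem //.
  by rewrite -horbasisE coord_free ?horbasis_free // eq_sym.
exact: (@sum_delta _ i j _ _ _ (c^~ i) (c^~ j)).
Qed.

Lemma bracket_coef_asym z i j k : bracket_coef z i j k = - bracket_coef z j i k.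
Proof.
rewrite /bracket_coef -[in RHS]mulN1r.
have := dot_linear (-1) (lie (@Xfield R j) (@Xfield R i) z) 0 (Xfield k z).
by rewrite dot0 !addr0 scaleN1r /lie opprB.
Qed.

Lemma sum_asym (c d : nat -> nat -> R) :
  (forall i j, c i j = - c j i) -> (forall i j, d i j = - d j i) ->
  \sum_(i < 4) \sum_(j < 4) c (i + 1)%N (j + 1)%N * d (i + 1)%N (j + 1)%N =
  2 * (c 1 2 * d 1 2 + c 1 3 * d 1 3 + c 2 3 * d 2 3 +
       c 1 4 * d 1 4 + c 2 4 * d 2 4 + c 3 4 * d 3 4).
Proof.
move=> cN dN; have c0 i : c i i = 0 by have := cN i i; lra.
rewrite !big_ord_recl !big_ord0 /= /bump /= !addr0 ?add0n ?addn1 ?add1n.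
rewrite !c0 (cN 2 1) (cN 3 1) (cN 3 2) (cN 4 1) (cN 4 2) (cN 4 3).
rewrite (dN 2 1) (dN 3 1) (dN 3 2) (dN 4 1) (dN 4 2) (dN 4 3); ring.
Qed.

Let e (n : nat) : 'rV[R]_4 := nth 0 [:: qi R; qj R; qk R] n.
Let m p (n k : nat) : R := dot4 (qmul p (e n)) (qmul (e k) p).

Lemma bracket_coef_table (x y : 'rV[R]_4) k : (k < 3)%N ->
  let c i j := bracket_coef (x, y) i j (k + 5) in
  [/\ c 1 2 = - 2 * m x 0 k + 2 * m y 0 k,
      c 1 3 = - 2 * m x 1 k + 2 * m y 1 k,
      c 2 3 = 2 * m x 2 k - 2 * m y 2 k &
   [/\ c 1 4 = 2 * m x 2 k + 2 * m y 2 k,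
      c 2 4 = 2 * m x 1 k + 2 * m y 1 k &
      c 3 4 = - 2 * m x 0 k - 2 * m y 0 k]].
Proof.
by case: k => [|[|[|//]]] _ c; (split; last split);
   rewrite /c /bracket_coef !lieE /m /dot /= !qmul_units !dot4E !qcE; ring.
Qed.

Lemma m_orth p k l : (k < 3)%N -> (l < 3)%N ->
  m p 0 k * m p 0 l + m p 1 k * m p 1 l + m p 2 k * m p 2 l =
  (k == l)%:R * dot4 p p ^+ 2.
Proof.
by case: k => [|[|[|//]]] _; case: l => [|[|[|//]]] _;
   rewrite /m /= ?mul1r ?mul0r !qmul_units !dot4E !qcE; ring.
Qed.

Lemma bracket_coef_gen z (k l : 'I_3) :
  \sum_(i < 4) \sum_(j < 4)
    bracket_coef z (i + 1) (j + 1) (k + 5) *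
    bracket_coef z (i + 1) (j + 1) (l + 5) =
  (k == l)%:R * (16 * (dot4 z.1 z.1 ^+ 2 + dot4 z.2 z.2 ^+ 2)).
Proof.
case: z => x y; rewrite -(inj_eq val_inj) /=.
have [] := bracket_coef_table x y (ltn_ord k).
have [] := bracket_coef_table x y (ltn_ord l).
have := m_orth x (ltn_ord k) (ltn_ord l); have := m_orth y (ltn_ord k) (ltn_ord l).
move: (nat_of_ord k) (nat_of_ord l) => {}k {}l Ey Ex.
move=> l12 l13 l23 [l14 l24 l34] k12 k13 k23 [k14 k24 k34].
have asym n a b := bracket_coef_asym (x, y) a b n.
have -> := sum_asym (asym (k + 5)%N) (asym (l + 5)%N).
rewrite l12 l13 l23 l14 l24 l34 k12 k13 k23 k14 k24 k34.
rewrite [RHS]mulrCA [in RHS]mulrDr -Ex -Ey; ring.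
Qed.

Lemma dot4_sq_gt0 z : dot z z == 1 ->
  0 < 16 * (dot4 z.1 z.1 ^+ 2 + dot4 z.2 z.2 ^+ 2).
Proof.
rewrite /dot => /eqP; move: (dot4 _ _) (dot4 _ _) => a b ab.
have := sqr_ge0 (a - b); rewrite (_ : b = 1 - a); last by lra.
nra.
Qed.

Section WithPoint.
Variables (z : H2 R) (z1 : dot z z == 1).

Fact tangent_ip_linear a (u u' v : subvs_of (Hsp z)) :
  tangent_ip (a *: u + u') v = a * tangent_ip u v + tangent_ip u' v.
Proof. exact: dot_linear. Qed.

Fact tangent_ip_sym (u v : subvs_of (Hsp z)) : tangent_ip u v = tangent_ip v u.
Proof. exact: dot_sym. Qed.

Fact tangent_ip_pos (u : subvs_of (Hsp z)) : u != 0 -> 0 < tangent_ip u u.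
Proof.
move=> u0; apply: dot_pos; apply: contra u0 => /eqP E.
by apply/eqP/val_inj; rewrite /= E.
Qed.

Fact tangent_bra_linear a (u u' v : subvs_of (Hsp z)) :
  tangent_bra (a *: u + u') v = a *: tangent_bra u v + tangent_bra u' v.
Proof.
rewrite /tangent_bra scaler_sumr -big_split; apply: eq_bigr => i _.
rewrite /= scaler_sumr -big_split; apply: eq_bigr => j _.
by rewrite /= !linearP /= mulrDl scalerDl scalerA mulrA.
Qed.

Fact tangent_bra_alt (u v : subvs_of (Hsp z)) :
  tangent_bra u v = - tangent_bra v u.
Proof.
rewrite /tangent_bra exchange_big -sumrN; apply: eq_bigr => i _.
rewrite -sumrN; apply: eq_bigr => j _; rewrite mulrC -scalerN -sumrN.
congr (_ *: _); apply: eq_bigr => k _.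
by rewrite bracket_coef_asym scaleNr.
Qed.

Fact tangent_bra_span (W : {vspace subvs_of (Vsp z)}) :
  (forall u v : subvs_of (Hsp z), tangent_bra u v \in W) -> W = fullv.
Proof.
move=> hW; have c0 := lt0r_neq0 (dot4_sq_gt0 z1).
have XW (k : 'I_3) : vsproj (Vsp z) (Xfield (k + 5) z) \in W.
  set c := 16 * _ in c0.
  have E : c *: vsproj (Vsp z) (Xfield (k + 5) z) =
    \sum_(i < 4) \sum_(j < 4) bracket_coef z (i + 1) (j + 1) (k + 5) *:
      tangent_bra (vsproj (Hsp z) (Xfield (i + 1) z))
                  (vsproj (Hsp z) (Xfield (j + 1) z)).
    transitivity (\sum_(l < 3) ((k == l)%:R * c) *:
        vsproj (Vsp z) (Xfield (l + 5) z)).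
      rewrite (bigD1 k) //= eqxx mul1r big1 ?addr0 // => l lk.
      by rewrite eq_sym (negbTE lk) mul0r scale0r.
    under eq_bigr => l _ do rewrite -bracket_coef_gen scaler_suml.
    rewrite exchange_big; apply: eq_bigr => i _ /=.
    under eq_bigr => l _ do rewrite scaler_suml.
    rewrite exchange_big; apply: eq_bigr => j _ /=.
    rewrite tangent_bra_basis // scaler_sumr; apply: eq_bigr => l _.
    by rewrite scalerA.
  rewrite -[X in X \in _](scalerK c0) E memvZ // rpred_sum // => i _.
  by rewrite rpred_sum // => j _; rewrite memvZ.
apply/eqP; rewrite eqEsubv subvf; apply/subvP => u _.
have := coord_span (valP u) => E.
have -> : u = \sum_(k < 3) coord (vertbasis z) k (val u) *:
    vsproj (Vsp z) (Xfield (k + 5) z).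
  apply: val_inj; rewrite [LHS]E /= linear_sum; apply: eq_bigr => k _.
  transitivity (coord (vertbasis z) k (val u) *: Xfield (k + 5) z).
    by rewrite vertbasisE.
  by rewrite -[in LHS](vsprojK (Vsp_mem z k)).
by rewrite rpred_sum // => k _; rewrite memvZ.
Qed.

Fact Vsp_neq0 : (fullv : {vspace subvs_of (Vsp z)}) != 0%VS.
Proof.
apply/negP => /eqP E.
have := memvf (vsproj (Vsp z) (Xfield (@ord0 2 + 5) z)).
rewrite E memv0 => /eqP /(congr1 val) /=; rewrite vsprojK; last exact: (Vsp_mem z ord0).
move=> X0.
have : dot (Xfield 5 z) (Xfield 5 z) = (5 == 5)%N%:R * dot z z.
  exact: Xfield_orthonormal.
by rewrite X0 dot0 (eqP z1) mul1r => /esym/eqP; rewrite oner_eq0.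
Qed.

End WithPoint.

End TangentAlgebra.

Definition tangent_algebra (R : realType) (z : S7 R) : carnot2 R :=
  Carnot2 (@tangent_ip_linear R (val z)) (@tangent_ip_sym R (val z))
    (@tangent_ip_pos R (val z)) (@tangent_bra_linear R (val z))
    (@tangent_bra_alt R (val z)) (tangent_bra_span (valP z))
    (Vsp_neq0 (valP z)).

(* Main.v *)
Require Import Defs.
From HB Require Import structures.
From mathcomp Require Import all_boot all_order all_algebra.
From mathcomp Require Import all_classical all_reals all_analysis.
From mathcomp Require Import ring lra.

Set Implicit Arguments.
Unset Strict Implicit.
Unset Printing Implicit Defensive.

Import Order.TTheory GRing.Theory Num.Theory.

Local Open Scope ring_scope.

(* J_Z is invertible iff the skew 4x4 matrix of (X, Y) |-> Z [X, Y] in the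
   basis X_1, ..., X_4 is, i.e. iff its Pfaffian is nonzero. Writing
   a_n = \sum_k Z(X_(k+5)) <x e_n, e_k x> and b_n for the same expression in y,
   with e_0, e_1, e_2 = i, j, k, the entries of that matrix are
   2 (+- a_n +- b_n) and the Pfaffian is 4 (|a|^2 - |b|^2). As u |-> x^-1 u x
   rotates the imaginary quaternions, this is
   4 |Z|^2 (|x|^4 - |y|^4) = 4 |Z|^2 (|x|^2 - |y|^2). *)

(* Needed because the instance declarations of [Defs] leave [fun_of_lfun]
   without usable linear structure: [linearP] fails on ['Hom(U, V)]. *)
Lemma hom_linear (R : realType) (U V : vectType R) (f : 'Hom(U, V)) : linear f.
Proof.
have [fZ fD] := lfun_is_semilinear f.
by move=> a u v; rewrite fD fZ.
Qed.

Lemma hom0 (R : realType) (U V : vectType R) (f : 'Hom(U, V)) : f 0 = 0.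
Proof.
by have := hom_linear f (-1) 0 0; rewrite scaler0 addr0 scaleN1r addNr.
Qed.

Lemma hom_sum (R : realType) (U : vectType R) n (f : 'Hom(U, R^o))
    (c : 'I_n -> R) (v : 'I_n -> U) :
  f (\sum_(i < n) c i *: v i) = \sum_(i < n) c i * f (v i).
Proof.
by elim/big_rec2: _ => [|i b d _ <-]; [exact: hom0 | exact: hom_linear].
Qed.

(** * Kernel of J_Z and the Pfaffian in dimension four *)

Section Pfaffian.
Context {R : realType} {g : carnot2 R} (Z : 'Hom(g2 g, R^o)).
Implicit Types X Y : g1 g.

Definition form X Y : R := Z (bra X Y).

Lemma form_linear a X X' Y : form (a *: X + X') Y = a * form X Y + form X' Y.
Proof. by rewrite /form bra_linear hom_linear. Qed.

Lemma form_asym X Y : form X Y = - form Y X.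
Proof.
by rewrite /form bra_alt -scaleN1r -[_ *: _]addr0 hom_linear hom0 addr0 scaleN1r.
Qed.

Lemma form_alt X : form X X = 0.
Proof. by have := form_asym X X; lra. Qed.

Lemma form0 Y : form 0 Y = 0.
Proof. by have := form_linear (-1) 0 0 Y; rewrite scaler0 addr0; lra. Qed.

(** The inner product is definite, so the kernel of J_Z is the radical of [form]. *)
Lemma Jmap_eq0 X : (Jmap Z X = 0) <-> (forall Y, form X Y = 0).
Proof.
have J := JmapP Z; split=> [E Y|E]; first by rewrite /form -J E ip0.
by apply/eqP; apply: contraT => /ip_pos; rewrite J [Z _]E ltxx.
Qed.

Lemma Jmap_bij : bijective (Jmap Z) <-> (forall X, Jmap Z X = 0 -> X = 0).
Proof.
split=> [/bij_inj inj X E|inj]; first by apply: inj; rewrite E hom0.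
have k0 : lker (Jmap Z) == 0%VS.
  by rewrite -subv0; apply/subvP => X; rewrite memv_ker memv0 => /eqP/inj ->.
exact: Bijective (lker0_lfunK k0) (lker0_lfunVK k0).
Qed.

Section Basis.
Context {e0 e1 e2 e3 : g1 g} (be : basis_of fullv [:: e0; e1; e2; e3]).

Definition comb4 (a b c d : R) : g1 g := a *: e0 + b *: e1 + c *: e2 + d *: e3.

Lemma basis4_span X : exists a b c d, X = comb4 a b c d.
Proof.
have := coord_basis (X := [tuple e0; e1; e2; e3]) be (memvf X).
rewrite !big_ord_recl big_ord0 /= addr0 !addrA => E.
by do 4 eexists; exact: E.
Qed.

Lemma basis4_free a b c d :
  comb4 a b c d = 0 -> [/\ a = 0, b = 0, c = 0 & d = 0].
Proof.
have /freeP fe := basis_free be => E.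
have {}fe := fe (fun i => [:: a; b; c; d]`_i) _; rewrite /= in fe.
have {}fe : forall i : 'I_4, [:: a; b; c; d]`_i = 0.
  by apply: fe; rewrite !big_ord_recl big_ord0 /= addr0 !addrA.
by split; [exact: (fe (@Ordinal 4 0 isT)) | exact: (fe (@Ordinal 4 1 isT))
  | exact: (fe (@Ordinal 4 2 isT)) | exact: (fe (@Ordinal 4 3 isT))].
Qed.

Lemma form_comb4 a b c d Y : form (comb4 a b c d) Y =
  a * form e0 Y + b * form e1 Y + c * form e2 Y + d * form e3 Y.
Proof.
by rewrite /comb4 -[d *: e3]addr0 -!addrA !form_linear form0 addr0.
Qed.

Lemma Jmap_eq0_basis4 X :
  form X e0 = 0 -> form X e1 = 0 -> form X e2 = 0 -> form X e3 = 0 ->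
  Jmap Z X = 0.
Proof.
move=> X0 X1 X2 X3; apply/Jmap_eq0 => Y.
have [a [b [c [d ->]]]] := basis4_span Y.
by rewrite form_asym form_comb4 ![form _ X]form_asym X0 X1 X2 X3; ring.
Qed.

Definition pfaffian4 : R :=
  form e0 e1 * form e2 e3 - form e0 e2 * form e1 e3 + form e0 e3 * form e1 e2.

(* If [B] is the matrix of the form and [B'] is obtained from it by exchanging
   complementary entries, then [B' B] is, up to sign, the Pfaffian times the
   identity. The combinations of the [e_i] and of the equations below are given
   by the rows of [B']. *)
Lemma Jmap_bij_pfaffian : bijective (Jmap Z) <-> pfaffian4 <> 0.
Proof.
have f10 := form_asym e1 e0; have f20 := form_asym e2 e0.
have f30 := form_asym e3 e0; have f21 := form_asym e2 e1.
have f31 := form_asym e3 e1; have f32 := form_asym e3 e2.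
have fE := (form_alt, f10, f20, f30, f21, f31, f32).
rewrite Jmap_bij /pfaffian4; split=> [inj p0|p0 X /Jmap_eq0 E].
  have ker a b c d : form (comb4 a b c d) e0 = 0 ->
      form (comb4 a b c d) e1 = 0 -> form (comb4 a b c d) e2 = 0 ->
      form (comb4 a b c d) e3 = 0 -> [/\ a = 0, b = 0, c = 0 & d = 0].
    by move=> *; apply/basis4_free/inj/Jmap_eq0_basis4.
  (* When the Pfaffian is zero, rows of B' lie in the radical, so their entries vanish. Then
     [form e0] is zero on the basis, which puts [e0] itself in the radical and contradicts
     freeness. *)
  have [||||_ w23 /eqP w13 w12] := ker 0 (form e2 e3) (- form e1 e3) (form e1 e2);
    rewrite ?form_comb4 ?fE; try lra.
  have [||||_ /eqP w02 w01 _] := ker (form e1 e2) (- form e0 e2) (form e0 e1) 0;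
    rewrite ?form_comb4 ?fE; try lra.
  have [||||_ _ /eqP w03 _] := ker (form e2 e3) 0 (- form e0 e3) (form e0 e2);
    rewrite ?form_comb4 ?fE; try lra.
  rewrite !oppr_eq0 in w13 w02 w03.
  have [||||/eqP] := ker 1 0 0 0; last by rewrite oner_eq0.
  - by rewrite form_comb4 ?fE; ring.
  - by rewrite form_comb4 ?fE w01; ring.
  - by rewrite form_comb4 ?fE (eqP w02); ring.
  - by rewrite form_comb4 ?fE (eqP w03); ring.
have [a [b [c [d Xc]]]] := basis4_span X.
have [E0 E1 E2 E3] := And4 (E e0) (E e1) (E e2) (E e3).
rewrite Xc !form_comb4 ?fE in E0 E1 E2 E3.
set p := (X in X <> 0) in p0.
have cancel_p x : p * x = 0 -> x = 0.
  by move=> /eqP; rewrite mulf_eq0 => /orP[/eqP|/eqP].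
(* With the equations already multiplied by entries of the form, only a linear combination of
   monomials is left to [lra]. *)
have scale0 s (x : R) : x = 0 -> s * x = 0 by move->; rewrite mulr0.
have a0 : a = 0.
  apply: cancel_p; have := scale0 (form e2 e3) _ E1.
  have := scale0 (form e1 e3) _ E2; have := scale0 (form e1 e2) _ E3.
  by rewrite /p; lra.
have b0 : b = 0.
  apply: cancel_p; have := scale0 (form e2 e3) _ E0.
  have := scale0 (form e0 e3) _ E2; have := scale0 (form e0 e2) _ E3.
  by rewrite /p; lra.
have c0 : c = 0.
  apply: cancel_p; have := scale0 (form e1 e3) _ E0.
  have := scale0 (form e0 e3) _ E1; have := scale0 (form e0 e1) _ E3.
  by rewrite /p; lra.
have d0 : d = 0.
  apply: cancel_p; have := scale0 (form e1 e2) _ E0.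
  have := scale0 (form e0 e2) _ E1; have := scale0 (form e0 e1) _ E2.
  by rewrite /p; lra.
by rewrite Xc a0 b0 c0 d0 /comb4 !scale0r !addr0.
Qed.

End Basis.
End Pfaffian.

(** * The Pfaffian of the bracket coefficients *)

Section SphereBracket.
Context {R : realType}.
Implicit Types (p x y : 'rV[R]_4) (zeta : 'I_3 -> R).

(** This is the n-th imaginary coordinate of conj(p) e_k p; for p nonzero, |p|^2 times the matrix of
    the rotation u |-> p^-1 u p. *)
Definition qrot p (n k : nat) : R :=
  let e := nth 0 [:: qi R; qj R; qk R] in dot4 (qmul p (e n)) (qmul (e k) p).

Definition qrot_vec p zeta (n : nat) : R := \sum_(k < 3) qrot p n k * zeta k.

(** The quaternion norm is multiplicative: |conj(p) zeta p| = |p|^2 |zeta|. *)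
Lemma qrot_vec_norm p zeta :
  qrot_vec p zeta 0 ^+ 2 + qrot_vec p zeta 1 ^+ 2 + qrot_vec p zeta 2 ^+ 2 =
  (\sum_(k < 3) zeta k ^+ 2) * dot4 p p ^+ 2.
Proof.
rewrite /qrot_vec !big_ord_recl !big_ord0 /qrot /bump /= !qmul_units !dot4E !qcE.
ring.
Qed.

(** Complementary entries involve the same index n, and their product is, up to sign, the difference
    of squares 4 (a_n^2 - b_n^2). The signs of the Pfaffian make the three terms add up to 4 (|a|^2
    - |b|^2). *)
Lemma pfaffian_bracket x y zeta :
  let c i j := \sum_(k < 3) bracket_coef (x, y) i j (k + 5) * zeta k in
  c 1%N 2%N * c 3%N 4%N - c 1%N 3%N * c 2%N 4%N + c 1%N 4%N * c 2%N 3%N =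
  4 * (\sum_(k < 3) zeta k ^+ 2) * (dot4 x x ^+ 2 - dot4 y y ^+ 2).
Proof.
move=> c.
have cE i j n s t :
    (forall k, (k < 3)%N -> bracket_coef (x, y) i j (k + 5) =
       s * qrot x n k + t * qrot y n k) ->
    c i j = s * qrot_vec x zeta n + t * qrot_vec y zeta n.
  move=> E; rewrite /c /qrot_vec !mulr_sumr -big_split; apply: eq_bigr => k _ /=.
  by rewrite E //; ring.
have tab k (k3 : (k < 3)%N) := bracket_coef_table x y k3.
rewrite (cE 1%N 2%N 0%N (-2) 2); last by move=> k /tab[-> _ _ _]; rewrite /qrot; ring.
rewrite (cE 1%N 3%N 1%N (-2) 2); last by move=> k /tab[_ -> _ _]; rewrite /qrot; ring.
rewrite (cE 2%N 3%N 2%N 2 (-2)); last by move=> k /tab[_ _ -> _]; rewrite /qrot; ring.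
rewrite (cE 1%N 4%N 2%N 2 2); last by move=> k /tab[_ _ _ [-> _ _]]; rewrite /qrot; ring.
rewrite (cE 2%N 4%N 1%N 2 2); last by move=> k /tab[_ _ _ [_ -> _]]; rewrite /qrot; ring.
rewrite (cE 3%N 4%N 0%N (-2) (-2)); last first.
  by move=> k /tab[_ _ _ [_ _ ->]]; rewrite /qrot; ring.
by rewrite mulrBr -!mulrA -!qrot_vec_norm; ring.
Qed.

End SphereBracket.

(** * The tangent algebra in the bases given by the fields *)

Section TangentPfaffian.
Context {R : realType} (z : S7 R).
Let g := tangent_algebra z.

(** For l = 1, ..., 4 the vector X_l(z) already lies in H_z, so [vsproj] only changes its type. *)
Definition hor (l : nat) : g1 g := vsproj (Hsp (val z)) (Xfield l (val z)).
Definition ver (k : 'I_3) : g2 g := vsproj (Vsp (val z)) (Xfield (k + 5) (val z)).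

Lemma form_hor (Z : 'Hom(g2 g, R^o)) i j : (0 < i < 5)%N -> (0 < j < 5)%N ->
  form Z (hor i) (hor j) =
  \sum_(k < 3) bracket_coef (val z) i j (k + 5) * Z (ver k).
Proof.
case: i => [|i] //= i4; case: j => [|j] //= j4; rewrite -hom_sum.
have := tangent_bra_basis (@Ordinal 4 i i4) (@Ordinal 4 j j4) (valP z).
rewrite /= !addn1 => E.
(* [bra] of the tangent algebra is [tangent_bra] by conversion. *)
have {}E : bra (hor i.+1) (hor j.+1) =
    \sum_(k < 3) bracket_coef (val z) i.+1 j.+1 (k + 5) *: ver k.
  exact: E.
by rewrite /form E.
Qed.

(** Freeness of [horbasis] gives dim H_z = 4, so it is enough that the four vectors span. *)
Lemma hor_basis : basis_of fullv [:: hor 1; hor 2; hor 3; hor 4].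
Proof.
rewrite basisEdim; apply/andP; split; last first.
  have := horbasis_free (valP z).
  by rewrite /free size_tuple dimvf => /eqP E; rewrite -[X in (X <= _)%N]E.
apply/subvP => u _.
have -> : u = \sum_(i < 4) coord (horbasis (val z)) i (val u) *: hor (i + 1).
  apply: val_inj; rewrite {1}(coord_span (valP u)) linear_sum.
  by apply: eq_bigr => i _; rewrite linearZ /= vsprojK ?Hsp_mem // horbasisE.
apply: rpred_sum => i _; apply: memvZ; apply: memv_span.
apply: (map_f hor (s := iota 1 4)).
by rewrite mem_iota addn1 /= ltnS ltn_ord.
Qed.

Lemma ver_span (u : g2 g) :
  u = \sum_(k < 3) coord (vertbasis (val z)) k (val u) *: ver k.
Proof.
apply: val_inj; rewrite {1}(coord_span (valP u)) linear_sum.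
by apply: eq_bigr => k _; rewrite linearZ /= vsprojK ?Vsp_mem // vertbasisE.
Qed.

(** A functional that vanishes on the spanning vectors [ver k] is zero. The sum is the factor |Z|^2
    of the Pfaffian. *)
Lemma hom_ver_neq0 (Z : 'Hom(g2 g, R^o)) :
  Z != 0 -> \sum_(k < 3) Z (ver k) ^+ 2 != 0.
Proof.
apply: contra; rewrite psumr_eq0 => [/allP Z0|k _]; last exact: sqr_ge0.
apply/eqP/lfunP => u; rewrite (ver_span u) hom_sum big1 ?lfunE // => k _.
have := Z0 k (mem_index_enum k).
by rewrite /= expf_eq0 /= => /eqP ->; rewrite mulr0.
Qed.

Lemma Jmap_tangent_bij (Z : 'Hom(g2 g, R^o)) : Z != 0 ->
  bijective (Jmap Z) <-> dot4 (val z).1 (val z).1 <> dot4 (val z).2 (val z).2.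
Proof.
move=> Z0; apply: (iff_trans (Jmap_bij_pfaffian Z hor_basis)).
rewrite /pfaffian4 !form_hor //.
have := pfaffian_bracket (val z).1 (val z).2 (fun k => Z (ver k)).
rewrite -surjective_pairing /= => ->.
have := eqP (valP z); rewrite /dot.
have := hom_ver_neq0 Z0; move: (\sum_k _) => s s0.
move: (dot4 _ _) (dot4 _ _) => b a ab.
(* On the sphere a + b = 1. *)
have -> : 4 * s * (a ^+ 2 - b ^+ 2) = 4 * s * (a - b).
  by rewrite subr_sqr ab mulr1.
split=> [h E|h /eqP]; first by apply: h; rewrite E subrr mulr0.
by rewrite !mulf_eq0 (negbTE s0) pnatr_eq0 /= subr_eq0 => /eqP.
Qed.

End TangentPfaffian.

(** * Existence of a nonzero functional, and the passage to norms *)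

(** Nonsingularity speaks only of nonzero functionals, so one is needed to draw a conclusion from
    it; the coordinate along a nonzero vector serves. *)
Lemma exists_hom_neq0 (R : realType) (V : vectType R) :
  (fullv : {vspace V}) != 0%VS -> exists f : 'Hom(V, R^o), f != 0.
Proof.
rewrite -vpick0 => v0; set v := vpick _ in v0.
exists (linfun (coord [tuple v] ord0 : V -> R^o)); apply/eqP => /lfunP /(_ v).
rewrite !lfunE /= => E.
have := coord_free (X := [tuple v]) ord0 ord0; rewrite /= E seq1_free => /(_ v0).
by move/eqP; rewrite eq_sym oner_eq0.
Qed.

Lemma dot4_ge0 (R : realType) (p : 'rV[R]_4) : 0 <= dot4 p p.
Proof. by rewrite sumr_ge0 // => i _; rewrite -expr2 sqr_ge0. Qed.

Lemma norm4_eq (R : realType) (p q : 'rV[R]_4) :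
  norm4 p = norm4 q <-> dot4 p p = dot4 q q.
Proof.
split=> [/eqP|E]; last by rewrite /norm4 E.
by rewrite eqr_sqrt ?dot4_ge0 // => /eqP.
Qed.

Theorem lemma6p3 (R : realType) (z : S7 R) :
  nonsingular (tangent_algebra z) <-> norm4 (val z).1 <> norm4 (val z).2.
Proof.
split=> [ns /norm4_eq E|xy Z Z0].
  have [Z Z0] := exists_hom_neq0 (g2_neq0 (tangent_algebra z)).
  by have /(Jmap_tangent_bij Z0) := ns Z Z0.
by apply/(Jmap_tangent_bij Z0) => /norm4_eq.
Qed.
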